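(* Let $q$ be a power of a prime $p$, let $v\ge0$, and let $m=p^vn$ with $n=p_1^{e_1}\cdots p_s^{e_s}$, where $p_1,\dots,p_s$ are distinct odd primes different from $p$ and $e_1,\dots,e_s$ are positive integers. Fix a primitive root system $\eta=(\eta_1,\dots,\eta_s)$ modulo $n$. Then all the cyclic codes of length $m$ over $\mathbb{F}_q$ are given by $$C_\Omega=\left(\prod_{(y,x)\in\Sigma(n;q)}M_{\eta^{(y,x)},q}(X)^{\Omega(y,x)}\right)$$ for all choices of integers $0\le\Omega(y,x)\le p^v$, $(y,x)\in\Sigma(n;q)$, where $$M_{\eta^{(y,x)},q}(X)=\sum_{i=0}^{\omega_y}(-1)^{\omega_y-i}\Big(\sum_{\substack{U\subseteq\{0,\dots,\omega_y-1\}\\|U|=\omega_y-i}}\ \prod_{u\in U}\zeta_{p_1^{e_1-y_1-M_{y_1}}\cdots p_s^{e_s-y_s-M_{y_s}}}^{\eta_1^{x_1}\cdots\eta_s^{x_s}q^u}\Big)X^{p_1^{M_{y_1}}\cdots p_s^{M_{y_s}}\cdot i}.$$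
   Context: A cyclic code of length $m$ over $\mathbb{F}_q$ is an $\mathbb{F}_q$-subspace of $\mathbb{F}_q^m$ stable under the cyclic shift $(c_0,\dots,c_{m-1})\mapsto(c_{m-1},c_0,\dots,c_{m-2})$; via $(c_0,\dots,c_{m-1})\leftrightarrow\sum c_iX^i$ it is identified with an ideal of $\mathbb{F}_q[X]/(X^m-1)$, and $(f(X))$ denotes the ideal generated by $f$. A compatible family $\{\zeta_N:\gcd(N,q)=1\}$ is fixed, where $\zeta_N$ is a primitive $N$-th root of unity in an algebraic closure of $\mathbb{F}_q$ and $\zeta_N^{N/M}=\zeta_M$ whenever $M\mid N$. $v_\ell$ is the $\ell$-adic valuation; $\mathrm{ord}_N(q)$ is the multiplicative order, $\mathrm{ord}_1(q)=1$. An $s$-tuple $\eta=(\eta_1,\dots,\eta_s)$ of integers is a primitive root system modulo $p_1^{e_1}\cdots p_s^{e_s}$ if for every $i$: $\eta_i$ is a primitive root modulo $p_i^{d}$ for all $d\ge1$, and $\eta_i\equiv1\pmod{p_j^{e_j}}$ for every $j\ne i$. For $0\le y_i\le e_i$ put $f_{i,y_i}=\mathrm{ord}_{p_i^{e_i-y_i}}(q)$, $g_{i,y_i}=\phi(p_i^{e_i-y_i})/f_{i,y_i}$. $\Sigma(n;q)$ is the set of $2s$-tuples of integers $(y,x)=(y_1,\dots,y_s,x_1,\dots,x_s)$ with $0\le y_i\le e_i$ and $0\le x_i\le g_{i,y_i}\gcd(\mathrm{lcm}(f_{1,y_1},\dots,f_{i-1,y_{i-1}}),f_{i,y_i})-1$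 for all $i$ (for $i=1$ the gcd is understood to be $1$). $\eta^{(y,x)}=\eta_1^{x_1}\cdots\eta_s^{x_s}p_1^{y_1}\cdots p_s^{y_s}$; $m_{y_i}=\min\{e_i-y_i,1\}$; $\omega_y=\mathrm{lcm}(\mathrm{ord}_{p_1^{m_{y_1}}}(q),\dots,\mathrm{ord}_{p_s^{m_{y_s}}}(q))$; $M_{y_i}=\max\{e_i-y_i-v_{p_i}(q^{\omega_y}-1),0\}$. *)

(* Defs.v *)
From HB Require Import structures.
From mathcomp Require Import all_boot all_order all_algebra all_field.

Set Implicit Arguments.
Unset Strict Implicit.
Unset Printing Implicit Defensive.

Import GRing.Theory.
Local Open Scope ring_scope.

Definition cyclic_shift (F : fieldType) (m : nat) (c : 'rV[F]_m) : 'rV[F]_m :=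
  \row_i c 0 (ord_pred i).

Definition cyclic_code (F : fieldType) (m : nat) (C : {vspace 'rV[F]_m}) : Prop :=
  forall c, c \in C -> cyclic_shift c \in C.

(* The class of c_0 + c_1 X + ... + c_(m-1) X^(m-1) in F[X]/(X^m - 1).  The
   library quotient [{poly %/ h}] is the expected one as soon as [h] is monic
   and not constant, which holds here when m > 0. *)
Definition word_class (F : fieldType) (m : nat) (c : 'rV[F]_m) :
    {poly %/ ('X^m - 1 : {poly F})} :=
  in_qpoly ('X^m - 1) (rVpoly c).

Definition principal_ideal (R : comNzRingType) (a : R) (x : R) : Prop :=
  exists b : R, x = b * a.

Definition generated_code (F : fieldType) (m : nat) (f : {poly F})
    (c : 'rV[F]_m) : Prop :=
  principal_ideal (in_qpoly ('X^m - 1) f) (word_class c).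

(* The least k >= 1 such that a ^ k = 1 mod N, for N > 0 and a coprime to N.
   The search is over 1 <= k <= N, which suffices as the order is at most
   totient N; it returns N + 1 when a is not coprime to N. *)
Definition mult_order (N : nat) (a : int) : nat :=
  (find (fun k => (a ^+ k.+1 == 1 %[mod N])%Z) (iota 0 N)).+1.

Definition is_primitive_root (N : nat) (a : int) : Prop :=
  coprimez a N /\ mult_order N a = totient N.

Definition primitive_root_system (s : nat) (pr e : 'I_s -> nat)
    (eta : 'I_s -> int) : Prop :=
  forall i : 'I_s,
    (forall d : nat, (0 < d)%N -> is_primitive_root (pr i ^ d)%N (eta i)) /\
    (forall j : 'I_s, j != i -> (eta i = 1 %[mod (pr j ^ e j)%N])%Z).

(* [L] is an algebraic closure of [F] via [iota]. *)
Definition algebraic_closure (F : fieldType) (L : closedFieldType)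
    (iota : {rmorphism F -> L}) : Prop :=
  forall u : L, algebraicOver iota u.

Definition compatible_roots (q : nat) (L : fieldType) (zeta : nat -> L) : Prop :=
  (forall N : nat, coprime N q -> N.-primitive_root (zeta N)) /\
  (forall N M : nat, coprime N q -> (M %| N)%N ->
     zeta N ^+ (N %/ M)%N = zeta M).

Section CyclotomicData.

Variables (q s : nat) (pr e : 'I_s -> nat).

Section ForY.

Variable y : 'I_s -> nat.

Definition ford (i : 'I_s) : nat := mult_order (pr i ^ (e i - y i))%N q.

Definition gidx (i : 'I_s) : nat :=
  (totient (pr i ^ (e i - y i)) %/ ford i)%N.

(* For the first index the lcm is empty, hence 1, and so is the gcd. *)
Definition xbound (i : 'I_s) : nat :=
  (gidx i * gcdn (\big[lcmn/1]_(j < s | j < i) ford j) (ford i))%N.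

Definition omega : nat :=
  \big[lcmn/1%N]_(i < s) mult_order (pr i ^ minn (e i - y i) 1)%N q.

(* Truncated subtraction accounts for max {_, 0}. *)
Definition Mexp (i : 'I_s) : nat :=
  (e i - y i - logn (pr i) (q ^ omega - 1))%N.

End ForY.

Definition Ytuple : finType := {dffun forall i : 'I_s, 'I_(e i).+1}.

Definition nat_of_Y (y : Ytuple) (i : 'I_s) : nat := y i.

Definition Xtuple (y : Ytuple) : finType :=
  {dffun forall i : 'I_s, 'I_(xbound (nat_of_Y y) i)}.

(* The finite type of the pairs (y, x) with 0 <= y_i <= e_i and
   0 <= x_i <= xbound y i - 1 for all i. *)
Definition Sigma : finType := {y : Ytuple & Xtuple y}.

Definition yof (t : Sigma) (i : 'I_s) : nat := nat_of_Y (tag t) i.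

Definition xof (t : Sigma) (i : 'I_s) : nat := (tagged t : Xtuple _) i.

(* The exponents of zeta are integers, as the entries of eta may be negative. *)
Definition Mpoly (L : fieldType) (zeta : nat -> L) (eta : 'I_s -> int)
    (t : Sigma) : {poly L} :=
  let y := yof t in let x := xof t in let w := omega y in
  let z := zeta (\prod_(i < s) pr i ^ (e i - y i - Mexp y i))%N in
  \sum_(i < w.+1)
    ((-1) ^+ (w - i) *
     \sum_(U : {set 'I_w} | #|U| == (w - i)%N)
       \prod_(u in U) z ^ ((\prod_(j < s) eta j ^+ x j) * (q ^ u)%N%:Z))
    *: 'X^((\prod_(j < s) pr j ^ Mexp y j) * i)%N.

End CyclotomicData.

(* Main.v *)
(* Put N_y = n / (p_1^y_1 ... p_s^y_s).  An n-th root of unity of exact order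
   N_y is zeta_(N_y)^c with c prime to N_y, and its conjugates over F_q are the
   zeta_(N_y)^(c q^j), j < f_y, where f_y is the order of q modulo N_y, that is
   the lcm of the f_(i,y_i).  By lifting the exponent (the p_i are odd) f_y is
   omega_y * p_1^(M_(y_1)) ... p_s^(M_(y_s)), so that M_(eta^(y,x),q), which by
   Vieta is the product over u < omega_y of X^P - z^(eta^x q^u), where
   P = p_1^(M_(y_1)) ... p_s^(M_(y_s)), is exactly the product of the linear
   factors of one such orbit: it has coefficients in F_q and is irreducible.
   Distinct elements of Sigma give disjoint orbits, and since the number of
   admissible x is prod_i phi(p_i^(e_i - y_i)) / f_y, the sizes of the orbits
   add up to sum_y prod_i phi(p_i^(e_i - y_i)) = n.  Hence the product of all
   the M_(eta^(y,x),q) is X^n - 1, whose p^v-th power is X^m - 1, and the cyclic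
   codes correspond to the monic divisors of that polynomial. *)
Require Import Defs.
From HB Require Import structures.
From mathcomp Require Import all_boot all_order all_algebra all_field.
From mathcomp Require Import cyclic zify.

Set Implicit Arguments.
Unset Strict Implicit.
Unset Printing Implicit Defensive.

Import GRing.Theory.
Local Open Scope ring_scope.

(** * Orders and lifting the exponent *)

Lemma eqz_modX_nat (N a k : nat) :
  ((a%:Z ^+ k == 1 %[mod N%:Z])%Z) = (a ^ k == 1 %[mod N])%N.
Proof. by rewrite -natrXE -rmorphXn /= -[1]/(1%:Z) !modz_nat. Qed.

Lemma eqz_modX (N k : nat) (a b : int) : (a = b %[mod N])%Z ->
  ((a ^+ k == 1 %[mod N%:Z])%Z) = ((b ^+ k == 1 %[mod N%:Z])%Z).
Proof. by move=> ab; rewrite -modzXm ab modzXm. Qed.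

Lemma mult_order_mod (N : nat) (a b : int) :
  (a = b %[mod N])%Z -> mult_order N a = mult_order N b.
Proof.
by move=> ab; congr _.+1; apply: eq_find => k; rewrite (eqz_modX _ ab).
Qed.

Local Open Scope nat_scope.

Lemma modn_expn_period (N a w k : nat) :
  a ^ w = 1 %[mod N] -> a ^ k = a ^ (k %% w) %[mod N].
Proof.
move=> aw; rewrite [in LHS](divn_eq k w) expnD [k %/ w * w]mulnC expnM -modnMml.
by rewrite -modnXm aw modnXm exp1n modnMml mul1n.
Qed.

(** Euler's theorem and [totient N <= N] make the bounded search succeed. Its first hit is the least
    positive exponent, modulo which [k] is reduced. *)
Lemma mult_orderP (N a k : nat) : 0 < N -> coprime a N ->
  (mult_order N a %| k) = (a ^ k == 1 %[mod N]).
Proof.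
move=> N0 co.
set P := fun k : nat => (a%:Z ^+ k.+1 == 1 %[mod N%:Z])%Z.
have PE j : P j = (a ^ j.+1 == 1 %[mod N]) by exact: eqz_modX_nat.
have hasP : has P (iota 0 N).
  apply/hasP; exists (totient N).-1.
    rewrite mem_iota /= add0n prednK ?totient_gt0 // totient_count_coprime.
    apply: (@leq_trans (\sum_(0 <= d < N) 1)).
      by apply: leq_sum => i _; case: coprime.
    by rewrite sum_nat_const_nat muln1 subn0.
  by rewrite PE prednK ?totient_gt0 //; apply/eqP/Euler_exp_totient.
have oN : find P (iota 0 N) < N by move: hasP; rewrite has_find size_iota.
set o := mult_order N a.
have o1 : a ^ o = 1 %[mod N].
  by apply/eqP; rewrite -PE; have := nth_find 0 hasP; rewrite nth_iota.
have omin j : 0 < j < o -> a ^ j != 1 %[mod N].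
  case: j => // j /= jo; rewrite -PE.
  have jf : j < find P (iota 0 N) by [].
  by have := before_find 0 jf; rewrite nth_iota ?(ltn_trans jf oN) // => ->.
rewrite (modn_expn_period _ o1) /dvdn.
have ko : k %% o < o by rewrite ltn_pmod.
case: (posnP (k %% o)) => [-> //|k0]; first by rewrite expn0 eqxx.
by rewrite (negPf (omin _ _)) ?k0 //; apply/negbTE; rewrite -lt0n.
Qed.

(** For [j <= i] the difference factors as [a ^ j * (a ^ (i - j) - 1)], with [a ^ j] a unit modulo
    [N]. *)
Lemma eq_mod_expnP (N a i j : nat) : 0 < N -> coprime a N ->
  (a ^ i == a ^ j %[mod N]) = (i == j %[mod mult_order N a]).
Proof.
move=> N0 co; wlog le_ji : i j / j <= i.
  move=> IH; case: (leqP j i) => [|/ltnW] /IH //.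
  by rewrite eq_sym => ->; rewrite eq_sym.
rewrite [RHS]eqn_mod_dvd // mult_orderP //.
case: (posnP a) => [a0|a0].
  by move: co; rewrite a0 /coprime gcd0n => /eqP ->; rewrite !modn1.
rewrite eqn_mod_dvd ?leq_pexp2l //.
rewrite -[in LHS](subnK le_ji) expnD -[X in _ - X]mul1n -mulnBl.
by rewrite Gauss_dvdl ?coprimeXr 1?coprime_sym // eqn_mod_dvd // expn_gt0 a0.
Qed.

Lemma dvdn_prod_coprime (I : finType) (F : I -> nat) (k : nat) :
  (forall i j, i != j -> coprime (F i) (F j)) ->
  reflect (forall i, F i %| k) (\prod_i F i %| k).
Proof.
move=> co; apply: (iffP idP) => [d i|d].
  by apply: dvdn_trans d; rewrite (bigD1 i) //= dvdn_mulr.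
suff: uniq (index_enum I) -> \prod_(i <- index_enum I) F i %| k.
  by apply; exact: index_enum_uniq.
elim: (index_enum I) => [|i r IH] /=; first by rewrite big_nil dvd1n.
case/andP=> ir /IH dr; rewrite big_cons Gauss_dvd ?dr ?andbT //.
rewrite big_seq; apply: (big_ind (coprime (F i))) => [|x y cx cy|j jr].
- exact: coprimen1.
- by rewrite coprimeMr cx.
- by apply: co; apply: contraNneq ir => ->.
Qed.

(** Telescopes [gcdn l f * lcmn l f = l * f] over the indices; this is why the gcds in [xbound] give
    the right number of orbits. *)
Lemma lcm_gcd_prod (s : nat) (f : 'I_s -> nat) :
  (\prod_(i < s) gcdn (\big[lcmn/1]_(j < s | j < i) f j) (f i)) *
    \big[lcmn/1]_(i < s) f i = \prod_(i < s) f i.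
Proof.
suff H k : k <= s ->
  (\prod_(i < s | i < k) gcdn (\big[lcmn/1]_(j < s | j < i) f j) (f i)) *
    \big[lcmn/1]_(i < s | i < k) f i = \prod_(i < s | i < k) f i.
  have /= := H s (leqnn s).
  have E : (fun i : 'I_s => i < s) =1 xpredT by move=> i; rewrite ltn_ord.
  by rewrite !(eq_bigl _ _ E).
elim: k => [|k IH] ks; first by rewrite !big_pred0.
pose K := Ordinal ks.
have E (i : 'I_s) : (i < k.+1) && (i != K) = (i < k).
  by rewrite -val_eqE /=; lia.
rewrite !(bigD1 (P := fun i : 'I_s => i < k.+1) K) //=.
rewrite !(eq_bigl _ _ E) -(IH (ltnW ks)).
set l := \big[_/_]_(_ < _ | _) _; set g := \prod_(_ < _ | _) _.
rewrite lcmnC mulnAC [gcdn _ _ * _]mulnC muln_lcm_gcd; lia.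
Qed.

Lemma eqn_mod_coprimeMr (c a b N : nat) : coprime c N ->
  (a * c == b * c %[mod N]) = (a == b %[mod N]).
Proof.
move=> co; wlog ba : a b / b <= a.
  move=> IH; case: (leqP b a) => [|/ltnW] /IH //.
  by rewrite eq_sym => ->; rewrite eq_sym.
by rewrite !eqn_mod_dvd ?leq_mul // -mulnBl Gauss_dvdl // coprime_sym.
Qed.

(** [a ^ p - 1] is [a - 1] times a geometric sum. With [a = 1 + w * p] this sum is [p] plus [w * p]
    times [p * (p - 1) / 2] modulo [p ^ 2], hence just [p] because [p] is odd: its valuation is
    exactly 1. *)
Lemma logn_expn_sub1_prime (p a : nat) :
  prime p -> odd p -> 1 < a -> a = 1 %[mod p] ->
  logn p (a ^ p - 1) = (logn p (a - 1)).+1.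
Proof.
move=> pp op a1 ap.
have p0 := prime_gt0 pp.
have ap1 : p %| a - 1 by rewrite -eqn_mod_dvd ?ap // ltnW.
have S0 : 0 < \sum_(i < p) a ^ i.
  by case: (p) p0 => // r _; rewrite big_ord_recl expn0.
rewrite [in LHS]subn1 predn_exp -subn1 lognM ?subn_gt0 //.
have /dvdnP[w aw] := ap1.
have key i : a ^ i = 1 + i * (w * p) %[mod p ^ 2].
  elim: i => [|i IH]; first by rewrite mul0n.
  rewrite expnS -modnMmr IH modnMmr.
  have -> : a = 1 + w * p by rewrite -aw subnKC // ltnW.
  rewrite -[RHS](modnMDl (i * w * w)); congr (_ %% _); rewrite expnS expn1; lia.
have sumE : \sum_(i < p) a ^ i = p %[mod p ^ 2].
  have -> : \sum_(i < p) a ^ i = \sum_(i < p) (1 + i * (w * p)) %[mod p ^ 2].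
    elim/big_rec2: _ => // i x y _ IH.
    by rewrite -modnDml key modnDml -modnDmr IH modnDmr.
  rewrite big_split /= sum1_card card_ord -big_distrl /= -(big_mkord xpredT id).
  rewrite bin2_sum bin2odd // -[RHS](modnMDl (p.-1./2 * w)); congr (_ %% _).
  by rewrite expnS expn1; lia.
rewrite -[RHS]addn1; congr (_ + _).
apply/eqP; rewrite eqn_leq leqNgt -!pfactor_dvdn // expn1.
rewrite /dvdn sumE -/(dvdn _ _) gtnNdvd ?p0 //=; last first.
  by rewrite -{1}[p]expn1 ltn_exp2l ?prime_gt1.
rewrite -(@modn_dvdm (p ^ 2)) ?expnS ?dvdn_mulr // -expnS sumE.
by rewrite modn_dvdm ?modnn // expnS dvdn_mulr.
Qed.

(** Here the geometric sum is congruent to [k] modulo [p], hence prime to [p]. *)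
Lemma logn_expn_sub1_coprime (p a k : nat) :
  prime p -> 1 < a -> a = 1 %[mod p] -> ~~ (p %| k) ->
  logn p (a ^ k - 1) = logn p (a - 1).
Proof.
move=> pp a1 ap pk.
have k0 : 0 < k by case: k pk; rewrite ?dvdn0.
have S0 : 0 < \sum_(i < k) a ^ i.
  by case: (k) k0 => // r _; rewrite big_ord_recl expn0.
rewrite [in LHS]subn1 predn_exp -subn1 lognM ?subn_gt0 //.
rewrite -[RHS]addn0; congr (_ + _); apply/eqP.
rewrite -leqn0 leqNgt -pfactor_dvdn // expn1; apply: contra pk.
suff -> : (p %| \sum_(i < k) a ^ i) = (p %| k) by [].
rewrite /dvdn -[in RHS](card_ord k) -[in RHS]sum1_card; congr (_ == _).
elim/big_rec2: _ => // i x y _ IH.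
by rewrite -modnDml -modnXm ap modnXm exp1n modnDml -modnDmr IH modnDmr.
Qed.

Lemma logn_expn_sub1 (p a k : nat) :
  prime p -> odd p -> 1 < a -> a = 1 %[mod p] -> 0 < k ->
  logn p (a ^ k - 1) = logn p (a - 1) + logn p k.
Proof.
move=> pp op a1 ap; elim/ltn_ind: k => k IH k0.
have [/dvdnP[l kl]|pk] := boolP (p %| k); last first.
  by rewrite logn_expn_sub1_coprime // [logn p k]lognE pp k0 (negPf pk) addn0.
have l0 : 0 < l by case: l kl => // kl; rewrite kl in k0.
have lk : l < k by rewrite kl ltn_Pmulr ?prime_gt1.
have al1 : 1 < a ^ l by rewrite -(exp1n l) ltn_exp2r.
rewrite kl expnM logn_expn_sub1_prime //; last by rewrite -modnXm ap modnXm exp1n.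
by rewrite IH // lognM ?(prime_gt0 pp) // (logn_prime _ pp) eqxx addn1 addnS.
Qed.

(** * Cyclotomic cosets *)

Lemma sum_totient_pfactor (p d : nat) : prime p ->
  \sum_(j < d.+1) totient (p ^ (d - j)) = p ^ d.
Proof.
move=> pp; rewrite (reindex_inj rev_ord_inj) /=.
under eq_bigr => j _ do rewrite subKn -1?ltnS //.
elim: d => [|d IH]; first by rewrite big_ord_recr big_ord0.
by rewrite big_ord_recr /= IH totient_pfactor //= -mulSn prednK ?prime_gt0 // expnS.
Qed.

(** Distributivity over dependent functions: they are transported to functions into the disjoint
    union of the [T i] with each value in its own fibre, where the product of sums expands as
    usual. *)
Lemma sum_dffun_prod (I : finType) (T : I -> finType) (P : forall i, T i -> nat) :
  \sum_(y : {dffun forall i, T i}) \prod_i P i (y i) =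
  \prod_i \sum_(j : T i) P i j.
Proof.
rewrite (reindex (@dffun_of_fprod I T)); last exact/onW_bij/dffun_of_fprod_bij.
transitivity (\sum_(t : fprod T) \prod_(i in I) [ffun j => P i j] (t i)).
  by apply: eq_bigr => t _; apply: eq_bigr => i _; rewrite !ffunE.
rewrite big_fprod.
under [RHS]eq_bigr => i _ do rewrite big_tag.
rewrite (bigA_distr_big_dep (fun i => tagged_with T i)) /=.
apply: eq_bigr => g _; apply: eq_bigr => i _.
by rewrite /untag; case: eqP => // tg; rewrite ffunE.
Qed.

(** * Order of q modulo N_y and number of orbits *)

Section Orbits.

Variables (q s : nat) (pr e : 'I_s -> nat).
Hypotheses (q1 : 1 < q) (hpr : forall i, prime (pr i))
  (hinj : injective pr) (cop : forall i, coprime q (pr i)).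

Definition Ny (y : 'I_s -> nat) := \prod_(i < s) pr i ^ (e i - y i).
Definition orbit_size (y : 'I_s -> nat) := \big[lcmn/1]_(i < s) ford q pr e y i.

Lemma coprime_q_pow i d : coprime q (pr i ^ d).
Proof. exact: coprimeXr. Qed.

Lemma pow_gt0 i d : 0 < pr i ^ d.
Proof. by rewrite expn_gt0 prime_gt0. Qed.

Lemma coprime_pow i j d d' : i != j -> coprime (pr i ^ d) (pr j ^ d').
Proof.
move=> ij; rewrite coprimeXl // coprimeXr // prime_coprime //.
by rewrite dvdn_prime2 // (inj_eq hinj).
Qed.

Lemma Ny_gt0 y : 0 < Ny y.
Proof. by apply: prodn_gt0 => i; exact: pow_gt0. Qed.

Lemma eq_mod_prod_pow (a : 'I_s -> nat) (u v : nat) :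
  (u == v %[mod \prod_i pr i ^ a i]) <->
  (forall i, u == v %[mod pr i ^ a i]).
Proof.
wlog uv : u v / v <= u.
  move=> IH; case: (leqP v u) => [|/ltnW] /IH //.
  rewrite eq_sym => ->; split=> H i; by rewrite eq_sym.
rewrite eqn_mod_dvd //; split.
  move/dvdn_prod_coprime => H i; rewrite eqn_mod_dvd //.
  by apply: H => {}i j ij; exact: coprime_pow.
move=> H; apply/dvdn_prod_coprime => [i j ij|i]; first exact: coprime_pow.
by rewrite -eqn_mod_dvd.
Qed.

Lemma orbit_sizeP y k : (orbit_size y %| k) = (q ^ k == 1 %[mod Ny y]).
Proof.
apply/dvdn_biglcmP/idP => [H|/eq_mod_prod_pow H i _].
  apply/eq_mod_prod_pow => i; rewrite -mult_orderP ?pow_gt0 ?coprime_q_pow //.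
  exact: H.
by rewrite /ford mult_orderP ?pow_gt0 ?coprime_q_pow.
Qed.

Lemma omegaP y k :
  (omega q pr e y %| k) <-> forall i, y i < e i -> q ^ k == 1 %[mod pr i].
Proof.
split=> [/dvdn_biglcmP H i yi|H].
  have -> : pr i = pr i ^ minn (e i - y i) 1 by rewrite (minn_idPr _) ?subn_gt0.
  by rewrite -mult_orderP ?pow_gt0 ?coprime_q_pow //; exact: H.
apply/dvdn_biglcmP => i _; rewrite mult_orderP ?pow_gt0 ?coprime_q_pow //.
have [ye|ye] := ltnP (y i) (e i); first by rewrite (minn_idPr _) ?subn_gt0 ?H.
by rewrite (minn_idPl _) (eqP ye) // expn0 !modn1.
Qed.

Lemma omega_gt0 y : 0 < omega q pr e y.
Proof. by apply: (big_ind (leq 1)) => // a b a0 b0; rewrite lcmn_gt0 a0. Qed.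

Lemma orbit_size_gt0 y : 0 < orbit_size y.
Proof. by apply: (big_ind (leq 1)) => // a b a0 b0; rewrite lcmn_gt0 a0. Qed.

(** Both sides have the same multiples [k]: a multiple of either is a multiple of [omega], and
    lifting the exponent decides the rest one prime at a time. *)
Lemma orbit_sizeE y (hodd : forall i, odd (pr i)) :
  orbit_size y = omega q pr e y * \prod_(i < s) pr i ^ Mexp q pr e y i.
Proof.
set w := omega _ _ _ _.
have Q1 : 1 < q ^ w by rewrite -(exp1n w) ltn_exp2r ?omega_gt0.
suff H k : (orbit_size y %| k) = (w * \prod_(i < s) pr i ^ Mexp q pr e y i %| k).
  by apply/eqP; rewrite eqn_dvd H dvdnn -H dvdnn.
case: (posnP k) => [->|k0]; first by rewrite !dvdn0.
(* When [y i < e i], the base [q ^ w] is 1 modulo [pr i], so the valuation of [q ^ (w * k') - 1] is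
   that of [q ^ w - 1] plus that of [k']; the truncated subtraction in [Mexp] absorbs the case where
   the first already suffices. *)
have LTE k' i : 0 < k' ->
    (q ^ (w * k') == 1 %[mod pr i ^ (e i - y i)]) = (pr i ^ Mexp q pr e y i %| k').
  move=> k'0; rewrite pfactor_dvdn // /Mexp.
  have [ye|ye] := ltnP (y i) (e i); last first.
    by rewrite (eqP ye) // expn0 sub0n !modn1 eqxx leq0n.
  have /eqP Qi := (omegaP y w).1 (dvdnn w) i ye.
  rewrite eqn_mod_dvd ?expn_gt0 ?(ltnW q1) // pfactor_dvdn //; last first.
    by rewrite subn_gt0 -(exp1n (w * k')) ltn_exp2r // muln_gt0 k'0 omega_gt0.
  by rewrite expnM logn_expn_sub1 // [RHS]leq_subLR.
rewrite orbit_sizeP; apply/idP/idP => [H|/dvdnP[l kl]].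
  have /dvdnP[k' kk'] : w %| k.
    apply/omegaP => i ye; move/eq_mod_prod_pow: H => /(_ i).
    have -> : e i - y i = (e i - y i).-1.+1 by rewrite prednK ?subn_gt0.
    rewrite !eqn_mod_dvd ?expn_gt0 ?(ltnW q1) //; apply: dvdn_trans.
    by rewrite expnS dvdn_mulr.
  have k'0 : 0 < k' by case: k' kk' => // kk'; rewrite kk' in k0.
  rewrite kk' mulnC dvdn_pmul2r ?omega_gt0 //.
  apply/dvdn_prod_coprime => [i j ij|i]; first exact: coprime_pow.
  by rewrite -LTE // mulnC -kk'; move/eq_mod_prod_pow: H.
apply/eq_mod_prod_pow => i.
have kw : k = w * (l * \prod_(i < s) pr i ^ Mexp q pr e y i) by rewrite kl mulnCA.
rewrite kw LTE; last by move: k0; rewrite kw muln_gt0 => /andP[].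
by rewrite (bigD1 i) //= dvdn_mull // dvdn_mulr.
Qed.

Lemma prod_Mexp_dvd y : \prod_(i < s) pr i ^ Mexp q pr e y i %| Ny y.
Proof.
apply: (big_ind2 (fun a b => a %| b)) => // [a b c d|i _]; first exact: dvdn_mul.
by rewrite dvdn_exp2l // /Mexp leq_subr.
Qed.

(** Subtracting [Mexp] leaves an exponent at most the valuation of [q ^ omega - 1]. Hence the
    exponent of [q] matters only modulo [omega] in powers of the root of unity used by [Mpoly]. *)
Lemma omega_mod y :
  q ^ omega q pr e y == 1 %[mod \prod_(i < s) pr i ^ (e i - y i - Mexp q pr e y i)].
Proof.
apply/eq_mod_prod_pow => i.
rewrite eqn_mod_dvd ?expn_gt0 ?(ltnW q1) // pfactor_dvdn //; last first.
  by rewrite subn_gt0 -(exp1n (omega q pr e y)) ltn_exp2r ?omega_gt0.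
by rewrite /Mexp; lia.
Qed.

Lemma Ny_dvd y : Ny y %| \prod_(i < s) pr i ^ e i.
Proof.
apply: (big_ind2 (fun a b => a %| b)) => // [a b c d|i _]; first exact: dvdn_mul.
by rewrite dvdn_exp2l // leq_subr.
Qed.

Lemma Ny_div y :
  Ny y %/ \prod_(i < s) pr i ^ Mexp q pr e y i =
  \prod_(i < s) pr i ^ (e i - y i - Mexp q pr e y i).
Proof.
rewrite -[X in X %/ _](_ : (\prod_(i < s) pr i ^ (e i - y i - Mexp q pr e y i)) *
  \prod_(i < s) pr i ^ Mexp q pr e y i = Ny y); last first.
  rewrite -big_split /=; apply: eq_bigr => i _.
  by rewrite -expnD subnK // /Mexp leq_subr.
by rewrite mulnK //; apply: prodn_gt0 => i; exact: pow_gt0.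
Qed.

Lemma ford_dvd_totient y i : ford q pr e y i %| totient (pr i ^ (e i - y i)).
Proof.
rewrite /ford mult_orderP ?pow_gt0 ?coprime_q_pow //.
by rewrite Euler_exp_totient ?coprime_q_pow.
Qed.

(** Each [gidx i * ford i] is a totient, and the gcds in [xbound] times the lcm [orbit_size] restore
    the product of the [ford i]. *)
Lemma card_box y :
  (\prod_(i < s) xbound q pr e y i) * orbit_size y =
  \prod_(i < s) totient (pr i ^ (e i - y i)).
Proof.
rewrite /xbound big_split /= -mulnA lcm_gcd_prod -big_split /=.
by apply: eq_bigr => i _; rewrite divnK ?ford_dvd_totient.
Qed.

Lemma sum_orbit_size :
  \sum_(t : Sigma q pr e) orbit_size (yof t) = \prod_(i < s) pr i ^ e i.
Proof.
transitivity (\sum_(y : Ytuple e) \sum_(x : Xtuple q pr y) orbit_size (nat_of_Y y)).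
  by rewrite sig_big_dep.
transitivity (\sum_(y : Ytuple e) \prod_(i < s) totient (pr i ^ (e i - y i))).
  apply: eq_bigr => y _; rewrite sum_nat_const -card_box; congr (_ * _).
  rewrite card_dep_ffun foldrE big_image /=.
  by apply: eq_bigr => i _; rewrite card_ord.
rewrite (sum_dffun_prod (fun i (j : 'I_(e i).+1) => totient (pr i ^ (e i - j)))).
by apply: eq_bigr => i _; rewrite sum_totient_pfactor.
Qed.

(** The valuation at [pr i] is [e i - y i], which determines [y i] as long as [y i <= e i]. *)
Lemma Ny_inj y y' : (forall i, y i <= e i) -> (forall i, y' i <= e i) ->
  Ny y = Ny y' -> y =1 y'.
Proof.
move=> ye ye' E i.
suff H z : logn (pr i) (Ny z) = e i - z i.
  by have := H y; rewrite E H; have := ye i; have := ye' i; clear; lia.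
rewrite /Ny (bigD1 i) //= lognM ?pow_gt0 ?prodn_gt0 => //[|j]; last exact: pow_gt0.
rewrite pfactorK // -[RHS]addn0; congr (_ + _); apply: logn_coprime.
apply: (big_ind (coprime (pr i))) => [|a b ca cb|j ji]; first exact: coprimen1.
  by rewrite coprimeMr ca.
by rewrite -[pr i]expn1 coprime_pow // eq_sym.
Qed.

(** * Primitive root systems: distinct parameters give distinct orbits *)

Variables (E : 'I_s -> nat).
Hypotheses (ordE : forall i d, 0 < d -> d <= e i ->
    mult_order (pr i ^ d) (E i) = totient (pr i ^ d))
  (copE : forall i, coprime (E i) (pr i))
  (E1 : forall i j, j != i -> E i = 1 %[mod pr j ^ e j]).

Definition Ex (x : 'I_s -> nat) := \prod_(i < s) E i ^ x i.

Lemma prod_mod_eq1 (I : finType) (P : pred I) (G : I -> nat) N :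
  (forall i, P i -> G i = 1 %[mod N]) -> \prod_(i | P i) G i = 1 %[mod N].
Proof.
move=> H; elim/big_rec: _ => // i x Pi IH.
by rewrite -modnMm H // IH modnMm.
Qed.

(** The factors with [j != i] are 1 modulo [pr i ^ e i], so only the [i]-th one survives. *)
Lemma Ex_mod x i d : d <= e i -> Ex x = E i ^ x i %[mod pr i ^ d].
Proof.
move=> de; rewrite /Ex (bigD1 i) //= -modnMmr prod_mod_eq1 ?modnMmr ?muln1 // => j ji.
rewrite -modnXm; have -> : E j = 1 %[mod pr i ^ d].
  rewrite -(@modn_dvdm (pr i ^ e i)) ?dvdn_exp2l // E1 1?eq_sym //.
  by rewrite modn_dvdm // dvdn_exp2l.
by rewrite modnXm exp1n.
Qed.

Lemma coprime_Ex x y : coprime (Ex x) (Ny y).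
Proof.
have H i : coprime (Ex x) (pr i ^ (e i - y i)).
  by rewrite -coprime_modl Ex_mod ?leq_subr // coprime_modl coprimeXl // coprimeXr.
apply: (big_ind (coprime (Ex x))) => [|a b ca cb|//]; first exact: coprimen1.
by rewrite coprimeMr ca.
Qed.

Lemma coprime_q_Ny y : coprime q (Ny y).
Proof.
apply: (big_ind (coprime q)) => [|a b ca cb|i _]; first exact: coprimen1.
  by rewrite coprimeMr ca.
exact: coprime_q_pow.
Qed.

(* If x and x' give the same orbit, say Ex x * q^T = Ex x' modulo Ny y, then,
   inductively on i, the order f_i of q modulo pr i ^ (e i - y i) divides T for
   the previous indices, and hence so does their lcm l; raising the i-th
   congruence to the power f_i / gcd(l, f_i) kills q^T, so that x i and x' i
   agree modulo xbound y i. *)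
Lemma orbit_inj_le y x x' t t' :
  (forall i, x i < xbound q pr e y i) -> (forall i, x' i < xbound q pr e y i) ->
  t' <= t -> Ex x * q ^ t = Ex x' * q ^ t' %[mod Ny y] ->
  x =1 x' /\ q ^ t = q ^ t' %[mod Ny y].
Proof.
move=> xb xb' tt' H.
have {}H i : E i ^ x i * q ^ (t - t') = E i ^ x' i %[mod pr i ^ (e i - y i)].
  have /eq_mod_prod_pow/(_ i) : Ex x * q ^ t == Ex x' * q ^ t' %[mod Ny y] by apply/eqP.
  rewrite -modnMml Ex_mod ?leq_subr // modnMml.
  rewrite -[X in _ == X]modnMml Ex_mod ?leq_subr // modnMml.
  rewrite -{1}(subnK tt') expnD mulnA.
  set u := E i ^ _ * _; set v := E i ^ _; set N := pr i ^ _ => /eqP uv.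
  have cN : coprime (q ^ t') N by rewrite coprimeXl // coprime_q_pow.
  by apply/eqP; rewrite -(eqn_mod_coprimeMr _ _ cN); apply/eqP.
suff K k : forall i : 'I_s, i < k -> x i = x' i /\ ford q pr e y i %| t - t'.
  split; first by move=> i; have [] := K s i (ltn_ord i).
  apply/eqP; rewrite eq_mod_expnP ?Ny_gt0 ?coprime_q_Ny // eqn_mod_dvd //.
  rewrite mult_orderP ?Ny_gt0 ?coprime_q_Ny // -orbit_sizeP.
  by apply/dvdn_biglcmP => i _; have [] := K s i (ltn_ord i).
elim: k => // k IH i; rewrite ltnS leq_eqVlt => /orP[/eqP ik|]; last exact: IH.
set f := ford q pr e y i; set T := t - t' in H IH *.
set l := \big[lcmn/1]_(j < s | j < i) ford q pr e y j.
have lT : l %| T.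
  by apply/dvdn_biglcmP => j ji; have [] := IH j; rewrite -?ik.
set N := pr i ^ (e i - y i) in H *.
have cE d : coprime (E i) (pr i ^ d) by rewrite coprimeXr.
have N0 : 0 < N by exact: pow_gt0.
have ordN : mult_order N (E i) = totient N.
  (* If [e i - y i] is 0 the modulus is 1, which [ordE] does not cover; order and totient are then
     both 1. *)
  rewrite /N; case: (posnP (e i - y i)) => [->|]; last first.
    by move=> d0; rewrite ordE ?leq_subr.
  by rewrite expn0 /mult_order /= modz1.
have fT : f %| totient N by exact: ford_dvd_totient.
have f0 : 0 < f by [].
set g := gcdn l f; set r := f %/ g.
have rg : r * g = f by rewrite divnK ?dvdn_gcdr.
have r0 : 0 < r by move: f0; rewrite -rg muln_gt0 => /andP[].
have xx : x i = x' i.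
  have fTr : f %| T * r.
    rewrite -rg mulnC dvdn_pmul2r //.
    by apply: dvdn_trans lT; exact: dvdn_gcdl.
  have : E i ^ (x i * r) == E i ^ (x' i * r) %[mod N].
    have qTr : q ^ (T * r) = 1 %[mod N].
      by apply/eqP; rewrite -mult_orderP // coprime_q_pow.
    rewrite !expnM -[X in _ == X]modnXm -(H i) modnXm expnMn -expnM -(expnM q).
    by rewrite -modnMmr qTr modnMmr muln1.
  rewrite eq_mod_expnP ?cE // ordN.
  (* Since [g * r = f], dividing the congruence modulo [totient N] by [r] leaves one modulo
     [xbound], below which [x i] and [x' i] both lie. *)
  have -> : totient N = xbound q pr e y i * r.
    by rewrite /xbound -/l -/f -/g -mulnA [g * r]mulnC rg /gidx -/N -/f divnK.
  rewrite -!muln_modl eqn_pmul2r // !modn_small //; exact/eqP.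
split=> //.
rewrite /f /ford mult_orderP ?coprime_q_pow //.
(* Now that [x i = x' i], the unit [E i ^ x' i] cancels and leaves [q ^ T = 1]. *)
have cN : coprime (E i ^ x' i) N by rewrite coprimeXl // cE.
by rewrite -(eqn_mod_coprimeMr _ _ cN) mul1n mulnC -[in X in X == _]xx H.
Qed.

Lemma orbit_inj y x x' t t' :
  (forall i, x i < xbound q pr e y i) -> (forall i, x' i < xbound q pr e y i) ->
  Ex x * q ^ t = Ex x' * q ^ t' %[mod Ny y] ->
  x =1 x' /\ q ^ t = q ^ t' %[mod Ny y].
Proof.
move=> xb xb'; case: (leqP t' t) => [tt'|/ltnW tt'] H.
  exact: orbit_inj_le H.
by have [Hx Hq] := orbit_inj_le xb' xb tt' (esym H); split=> [i|]; rewrite ?Hx.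
Qed.

End Orbits.

Local Open Scope ring_scope.

(** * Factors of X^n - 1 *)

Section FrobeniusPower.

Variables (R : comNzRingType) (p k : nat).

(** The proof that the characteristic is [p] is an argument, so that the ring morphism structure can
    be attached to the map. It serves both on [L], as the [q]-th power, and on [{poly F}], as the
    [p ^ v]-th power. *)
Definition frob_pow (_ : p \in [pchar R]) (x : R) : R := x ^+ (p ^ k).

Variable hp : p \in [pchar R].

Fact frob_pow_is_zmod_morphism : zmod_morphism (frob_pow hp).
Proof.
have pn : [pchar R].-nat (p ^ k)%N.
  by rewrite pnatX pnatE ?hp ?orbT // (pcharf_prime hp).
move=> x y; rewrite /frob_pow.
have := exprDn_pchar (x - y) y pn; rewrite subrK => ->.
by rewrite addrK.
Qed.

Fact frob_pow_is_monoid_morphism : monoid_morphism (frob_pow hp).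
Proof. by split=> [|x y]; rewrite /frob_pow ?expr1n ?exprMn. Qed.

HB.instance Definition _ :=
  GRing.isZmodMorphism.Build R R (frob_pow hp) frob_pow_is_zmod_morphism.
HB.instance Definition _ :=
  GRing.isMonoidMorphism.Build R R (frob_pow hp) frob_pow_is_monoid_morphism.

End FrobeniusPower.

(** Vieta's formula: [U] is the set of factors contributing their constant, and the terms are
    grouped by the number [w - #|U|] of factors contributing the monomial. *)
Lemma prod_sub_monomial_expand (R : comNzRingType) (w P : nat) (c : 'I_w -> R) :
  \prod_(u < w) ('X^P - (c u)%:P) =
  \sum_(i < w.+1) ((-1) ^+ (w - i) *
     \sum_(U : {set 'I_w} | #|U| == (w - i)%N) \prod_(u in U) c u) *: 'X^(P * i)%N.
Proof.
under eq_bigr => u _ do rewrite addrC.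
rewrite (bigA_distr _ _ (fun u => - (c u)%:P) (fun _ => 'X^P)) /=.
rewrite (partition_big (fun U : {set 'I_w} => inord (w - #|U|) : 'I_w.+1) xpredT) //=.
apply: eq_bigr => i _.
have iw : (i <= w)%N by rewrite -ltnS.
have cE (U : {set 'I_w}) : ((inord (w - #|U|) : 'I_w.+1) == i) = (#|U| == (w - i)%N).
  have Uw : (#|U| <= w)%N by rewrite -[X in (_ <= X)%N]card_ord max_card.
  by rewrite -val_eqE /= inordK ?ltnS ?leq_subr //; apply/eqP/eqP => [<-|->]; rewrite subKn.
under eq_bigl => U do rewrite cE.
rewrite mulr_sumr scaler_suml; apply: eq_bigr => U /eqP cU.
rewrite (bigID (fun u => u \in U)) /=.
under eq_bigr => u uU do rewrite uU.
under [X in _ * X]eq_bigr => u uU do rewrite (negPf uU).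
rewrite prodrN -rmorph_prod /= cU.
have -> : \prod_(u | u \notin U) 'X^P = 'X^(P * i) :> {poly R}.
  rewrite prodr_const -exprM; congr ('X^_); congr (_ * _)%N.
  have -> : #|[predC U]| = #|~: U| by apply: eq_card => u; rewrite !inE.
  by rewrite cardsCs setCK card_ord cU subKn.
by rewrite -mul_polyC rmorphM rmorphXn rmorphN rmorph1.
Qed.

Lemma prim_root_exprz (L : fieldType) (N b : nat) (a : int) (z : L) :
  N.-primitive_root z -> (a = b %[mod N])%Z -> z ^ a = z ^+ b.
Proof.
move=> zN ab; have z0 : z != 0.
  apply/eqP => z0; move: (prim_expr_order zN) (oner_neq0 L).
  by rewrite z0 expr0n gtn_eqF ?(prim_order_gt0 zN) // => <-; rewrite eqxx.
have /dvdzP[c abc] : (N %| a - b%:Z)%Z by rewrite -eqz_mod_dvd; apply/eqP.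
have -> : a = b%:Z + N%:Z * c by rewrite mulrC -abc subrKC.
by rewrite expfzDr // -exprz_exp -!exprnP (prim_expr_order zN) exp1rz mulr1.
Qed.

(** The polynomial [X^#|F| - X] splits over [F], so all its roots in [L] come from [F]. *)
Lemma fixed_pow_card (F : finFieldType) (L : fieldType) (iota : {rmorphism F -> L})
  (x : L) : x ^+ #|F| = x -> exists a, iota a = x.
Proof.
move=> xx.
have : root (map_poly iota ('X^#|F| - 'X)) x.
  by rewrite rmorphB /= map_polyXn map_polyX rootE !hornerE xx subrr.
rewrite finField_genPoly rmorph_prod /= /root horner_prod prodf_seq_eq0.
case/hasP=> a _; rewrite rmorphB /= map_polyX map_polyC /= !hornerE subr_eq0.
by move/eqP => ->; exists a.
Qed.

Lemma map_poly_fixed_descent (F : finFieldType) (L : fieldType)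
  (iota : {rmorphism F -> L}) (P : {poly L}) :
  (forall i, P`_i ^+ #|F| = P`_i) -> exists Q, map_poly iota Q = P.
Proof.
move=> H.
have /fin_all_exists[a aP] : forall i : 'I_(size P), exists a, iota a = P`_i.
  by move=> i; apply: fixed_pow_card.
exists (\poly_(i < size P) (if insub i is Some j then a j else 0)).
apply/polyP => i; rewrite coef_map coef_poly.
case: ltnP => iP; last by rewrite nth_default //; exact: rmorph0.
by rewrite insubT; exact: aP.
Qed.

Section Factors.

Variables (p k q : nat) (hp : prime p) (hk : (0 < k)%N) (hq : q = (p ^ k)%N).
Variables (F : finFieldType) (hF : #|F| = q).
Variables (L : closedFieldType) (iota : {rmorphism F -> L}).
Variables (zeta : nat -> L) (hzeta : compatible_roots q zeta).
Variables (s : nat) (pr e : 'I_s -> nat).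
Hypotheses (hpr : forall i, prime (pr i)) (hodd : forall i, odd (pr i))
  (hneq : forall i, pr i != p) (hinj : injective pr)
  (he : forall i, (0 < e i)%N).
Variables (eta : 'I_s -> int) (heta : primitive_root_system pr e eta).

Let n := (\prod_(i < s) pr i ^ e i)%N.

(* The entries of eta may be negative; E i is the residue of eta i modulo n. *)
Let E (i : 'I_s) : nat := `|(eta i %% n)%Z|%N.

Let q1 : (1 < q)%N.
Proof. by rewrite hq -(exp1n k) ltn_exp2r ?prime_gt1. Qed.

Let cop i : coprime q (pr i).
Proof. by rewrite hq coprimeXl // prime_coprime // dvdn_prime2 // eq_sym. Qed.

Let n_gt0 : (0 < n)%N.
Proof. by apply: prodn_gt0 => i; exact: pow_gt0. Qed.

Let etaE i : (eta i = (E i)%:Z %[mod n])%Z.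
Proof. by rewrite /E gez0_abs ?modz_ge0 ?modz_mod // -lt0n. Qed.

Let eqz_mod_dvdn (a b : int) (d N : nat) :
  (d %| N)%N -> (a = b %[mod N])%Z -> (a = b %[mod d])%Z.
Proof.
move=> dN /eqP; rewrite eqz_mod_dvd => H; apply/eqP.
by rewrite eqz_mod_dvd; apply: dvdz_trans H.
Qed.

Let pow_dvd_n i d : (d <= e i)%N -> (pr i ^ d %| n)%N.
Proof.
by move=> de; rewrite /n (bigD1 i) //= dvdn_mulr // dvdn_exp2l.
Qed.

Let ordE i d : (0 < d)%N -> (d <= e i)%N ->
  mult_order (pr i ^ d) (E i) = totient (pr i ^ d).
Proof.
move=> d0 de; have [H _] := heta i; have [_ <-] := H d d0.
by apply: mult_order_mod; apply: esym; apply: eqz_mod_dvdn (etaE i); exact: pow_dvd_n.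
Qed.

Let copE i : coprime (E i) (pr i).
Proof.
have [H _] := heta i; have [] := H 1%N isT; rewrite expn1 /coprimez => co _.
have H1 : (eta i = (E i)%:Z %[mod pr i])%Z.
  by apply: eqz_mod_dvdn (etaE i); rewrite -[X in (X %| _)%N]expn1 pow_dvd_n.
suff : coprimez (E i)%:Z (pr i) by [].
by rewrite /coprimez -gcdz_modl -H1 gcdz_modl.
Qed.

Let E1 i j : j != i -> (E i = 1 %[mod pr j ^ e j])%N.
Proof.
move=> ji; have [_ H] := heta i; apply/eqP.
rewrite -eqz_nat -!modz_nat -(H j ji); apply/eqP; apply: esym.
by apply: eqz_mod_dvdn (etaE i); exact: pow_dvd_n.
Qed.

Let prime_zeta y : (Ny pr e y).-primitive_root (zeta (Ny pr e y)).
Proof. by apply: hzeta.1; rewrite coprime_sym coprime_q_Ny. Qed.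

(** For fixed [t] the root of index [j] is the [q ^ j]-th power of the root of index 0, that is, one
    of its conjugates over [F]. *)
Definition orbit_root (t : Sigma q pr e) (j : nat) : L :=
  zeta (Ny pr e (yof t)) ^+ (Ex E (xof t) * q ^ j).

Let osize (t : Sigma q pr e) := orbit_size q pr e (yof t).

Lemma yof_le (t : Sigma q pr e) i : (yof t i <= e i)%N.
Proof. by rewrite -ltnS; exact: ltn_ord. Qed.

Lemma orbit_root_prim t j : (Ny pr e (yof t)).-primitive_root (orbit_root t j).
Proof.
rewrite prim_root_exp_coprime // coprimeMl (coprimeXl _ (coprime_q_Ny _ cop _)) andbT.
exact: coprime_Ex.
Qed.

Lemma orbit_rootX t j i : orbit_root t j ^+ (q ^ i) = orbit_root t (j + i).
Proof. by rewrite /orbit_root -exprM -mulnA -expnD. Qed.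

Lemma orbit_root_osize t j : orbit_root t (osize t + j) = orbit_root t j.
Proof.
apply/eqP; rewrite (eq_prim_root_expr (prime_zeta _)) expnD mulnCA -modnMml.
have /eqP -> : (q ^ osize t == 1 %[mod Ny pr e (yof t)])%N.
  by rewrite -(orbit_sizeP _ hpr hinj cop).
by rewrite modnMml mul1n.
Qed.

Lemma Sigma_eq (t t' : Sigma q pr e) :
  yof t =1 yof t' -> xof t =1 xof t' -> t = t'.
Proof.
case: t t' => [y x] [y' x'] /= yy.
have {}yy : y = y' by apply/ffunP => i; apply/val_inj; exact: yy.
subst y' => xx; congr existT.
by apply/ffunP => i; apply/val_inj; exact: xx.
Qed.

Lemma xof_lt (t : Sigma q pr e) i : (xof t i < xbound q pr e (yof t) i)%N.
Proof. exact: ltn_ord. Qed.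

(** The exact order of the root determines [y]; comparing exponents of the same root of unity then
    gives [x] and the power of [q] by [orbit_inj]. *)
Lemma orbit_root_inj t t' j j' : orbit_root t j = orbit_root t' j' ->
  t = t' /\ (j = j' %[mod osize t])%N.
Proof.
move=> H.
have yy : yof t =1 yof t'.
  refine (@Ny_inj _ pr e hpr hinj (yof t) (yof t') (yof_le t) (yof_le t') _).
  apply/eqP; rewrite eqn_dvd; apply/andP; split.
    rewrite (prim_order_dvd (orbit_root_prim t j)) H.
    by rewrite (prim_expr_order (orbit_root_prim t' j')).
  rewrite (prim_order_dvd (orbit_root_prim t' j')) -H.
  by rewrite (prim_expr_order (orbit_root_prim t j)).
move: H; case: t t' yy => [y x] [y' x'] /= yy.
have {}yy : y = y' by apply/ffunP => i; apply/val_inj; exact: yy.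
subst y' => /eqP; rewrite (eq_prim_root_expr (prime_zeta _)) => /eqP.
case/(orbit_inj hpr hinj cop ordE copE E1 (xof_lt (existT _ y x))
  (xof_lt (existT _ y x'))).
move=> xx /eqP; set t := existT _ y x; rewrite eq_mod_expnP ?Ny_gt0 ?coprime_q_Ny //.
have -> : mult_order (Ny pr e (yof t)) q = osize t.
  apply/eqP; rewrite eqn_dvd mult_orderP ?Ny_gt0 ?coprime_q_Ny // -orbit_sizeP // dvdnn.
  by rewrite orbit_sizeP // -mult_orderP ?Ny_gt0 ?coprime_q_Ny // dvdnn.
by move/eqP; split=> //; exact: Sigma_eq.
Qed.

Definition orbit (t : Sigma q pr e) : seq L := mkseq (orbit_root t) (osize t).

Lemma uniq_orbit t : uniq_roots (orbit t).
Proof.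
rewrite uniq_rootsE; apply/mkseq_uniqP => j j' jt jt' /orbit_root_inj[_].
by rewrite !modn_small.
Qed.

Lemma prod_orbit t :
  \prod_(z <- orbit t) ('X - z%:P) =
  \prod_(j < osize t) ('X - (orbit_root t j)%:P).
Proof.
rewrite big_map -(big_mkord xpredT (fun j => 'X - (orbit_root t j)%:P)).
by rewrite /index_iota subn0.
Qed.

(** The orbit roots indexed by pairs of [t] and [j] are pairwise distinct [n]-th roots of unity, and
    by [sum_orbit_size] there are [n] of them. *)
Lemma prod_orbit_XsubC :
  \prod_t \prod_(j < osize t) ('X - (orbit_root t j)%:P) = 'X^n - 1.
Proof.
pose T : finType := {t : Sigma q pr e & 'I_(osize t)}.
pose h (u : T) := orbit_root (tag u) (tagged u).
have h_inj : injective h.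
  move=> [t j] [t' j'] /orbit_root_inj /= [tt']; subst t'.
  by rewrite !modn_small // => /val_inj ->.
have cT : #|T| = n.
  rewrite /n -(sum_orbit_size _ hpr cop) -sum1_card.
  rewrite -(sig_big_dep xpredT (fun _ => xpredT) (fun _ _ => 1%N)) /=.
  by apply: eq_bigr => t _; rewrite sum1_card card_ord.
rewrite (sig_big_dep xpredT (fun _ => xpredT)
  (fun t (j : 'I_(osize t)) => 'X - (orbit_root t j)%:P)) /=.
have -> : \prod_(u : T) ('X - (h u)%:P) = \prod_(z <- codom h) ('X - z%:P).
  by rewrite big_image.
apply: esym; rewrite [LHS](@all_roots_prod_XsubC _ _ (codom h)).
- by rewrite (monicP (monicXnsubC _ n_gt0)) scale1r.
- by rewrite size_XnsubC // size_codom cT.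
- apply/allP => _ /codomP[[t j] ->]; rewrite rootE !hornerE subr_eq0.
  by rewrite -(prim_order_dvd (orbit_root_prim t j)) Ny_dvd.
- by rewrite uniq_rootsE map_inj_uniq // enum_uniq.
Qed.

(** * The polynomials [Mpoly] as orbit products, their descent to [F] and their irreducibility *)

Let pcharL : p \in [pchar L].
Proof. by apply: (rmorph_pchar iota); rewrite (@card_finPcharP F p k) // hF. Qed.

(** The [q]-th power is a ring morphism of [L] fixing the image of [F], so it fixes the coefficients
    and permutes the roots. *)
Lemma root_frob (d : {poly F}) (a : L) :
  root (map_poly iota d) a -> root (map_poly iota d) (a ^+ q).
Proof.
have -> : a ^+ q = frob_pow k pcharL a by rewrite /frob_pow -hq.
have dE : map_poly (frob_pow k pcharL) (map_poly iota d) = map_poly iota d.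
  apply/polyP => i; rewrite !coef_map /= /frob_pow -hq -rmorphXn /=.
  by rewrite -hF expf_card.
by move=> /rootP ra; rewrite rootE -dE horner_map /= ra rmorph0.
Qed.

Lemma Mpoly_exponent (x : 'I_s -> nat) :
  (\prod_(j < s) eta j ^+ x j = (Ex E x)%:Z %[mod n])%Z.
Proof.
apply: (big_ind2 (fun (a : int) (b : nat) => (a = b%:Z %[mod n])%Z)) => //.
  by move=> a b c d ab cd; rewrite PoszM -modzMm ab cd modzMm.
by move=> i _; rewrite -modzXm etaE modzXm -natrXE rmorphXn.
Qed.

Lemma MpolyE (t : Sigma q pr e) :
  Mpoly zeta eta t = \prod_(j < osize t) ('X - (orbit_root t j)%:P).
Proof.
rewrite /Mpoly; set y := yof t; set x := xof t.
set P := (\prod_(j < s) pr j ^ Mexp q pr e y j)%N; set w := omega q pr e y.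
set N' := (\prod_(i < s) _)%N; set a := \prod_(j < s) _.
have P0 : (0 < P)%N by apply: prodn_gt0 => i; exact: pow_gt0.
have N'0 : (0 < N')%N by apply: prodn_gt0 => i; exact: pow_gt0.
have osE : osize t = (w * P)%N by rewrite /osize orbit_sizeE.
have NE : Ny pr e y = (N' * P)%N.
  by rewrite /N' -(Ny_div q e hpr) divnK // prod_Mexp_dvd.
have coN : coprime (Ny pr e y) q by rewrite coprime_sym coprime_q_Ny.
have N'N : (N' %| Ny pr e y)%N by rewrite NE dvdn_mulr.
(* Compatibility of the family links the root of unity of [Mpoly] to the one that defines the
   orbit. *)
have zP : zeta N' = zeta (Ny pr e y) ^+ P.
  by rewrite -(hzeta.2 _ _ coN N'N) NE mulKn.
have zN' : N'.-primitive_root (zeta N').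
  by apply: hzeta.1; exact: coprime_dvdl N'N coN.
have aE : (a = (Ex E x)%:Z %[mod N'])%Z.
  by apply: eqz_mod_dvdn (Mpoly_exponent x); apply: dvdn_trans N'N (Ny_dvd _ _ _).
rewrite -(prod_sub_monomial_expand _ (fun u : 'I_w => zeta N' ^ (a * (q ^ u)%N%:Z))).
pose c (u : nat) := zeta N' ^+ (Ex E x * q ^ u).
have -> : \prod_(u < w) ('X^P - (zeta N' ^ (a * (q ^ u)%N%:Z))%:P) =
    \prod_(u < w) ('X^P - (c u)%:P).
  apply: eq_bigr => u _; congr (_ - _%:P); apply: prim_root_exprz zN' _.
  by rewrite PoszM -modzMml aE modzMml.
set M := \prod_(u < w) _.
have Mm : M \is monic by apply: monic_prod => u _; exact: monicXnsubC.
have sM : size M = (osize t).+1.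
  rewrite size_prod => [|u _]; last exact/monic_neq0/monicXnsubC.
  under eq_bigr => u _ do rewrite size_XnsubC //.
  by rewrite sum_nat_const card_ord osE mulnS -addnS addKn.
(* M is monic of degree w * P and vanishes on the orbit, which has w * P
   elements, so it is the product of the linear factors of the orbit. *)
rewrite [LHS](@all_roots_prod_XsubC _ _ (orbit t)); last exact: uniq_orbit.
- by rewrite (monicP Mm) scale1r prod_orbit.
- by rewrite size_mkseq.
- apply/allP => _ /mapP[j _ ->].
  have w0 : (0 < w)%N by exact: omega_gt0.
  (* The [P]-th power of an orbit root is a power of [zeta N'], where [q ^ j] matters only modulo
     [N']; as [q ^ w] is 1 there, the factor of index [j %% w] vanishes. *)
  pose u := Ordinal (ltn_pmod j w0).
  rewrite /M (bigD1 u) //= rootM rootE !hornerE subr_eq0.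
  suff -> : orbit_root t j ^+ P = c (j %% w)%N by rewrite eqxx.
  rewrite /orbit_root exprAC -zP; apply/eqP; rewrite (eq_prim_root_expr zN').
  rewrite -modnMmr -[X in _ == X]modnMmr; suff -> : q ^ j = q ^ (j %% w) %[mod N'] by [].
  by apply: modn_expn_period; apply/eqP; exact: omega_mod.
Qed.

(** The [q]-th power permutes the orbit cyclically, hence fixes the coefficients of the product,
    which therefore lie in [F]. *)
Lemma Mpoly_descent (t : Sigma q pr e) : exists Q, map_poly iota Q = Mpoly zeta eta t.
Proof.
apply: map_poly_fixed_descent => i; rewrite hF.
have E' : map_poly (frob_pow k pcharL) (Mpoly zeta eta t) = Mpoly zeta eta t.
  rewrite MpolyE rmorph_prod /=.
  transitivity (\prod_(j < osize t) ('X - (orbit_root t j.+1)%:P)).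
    apply: eq_bigr => j _; rewrite rmorphB /= map_polyX map_polyC /= /frob_pow -hq.
    by rewrite -addn1 -orbit_rootX expn1.
  have f0 : (0 < osize t)%N by exact: orbit_size_gt0.
  (* After the shift by one, the last root is the one of index 0, and the product is unchanged. *)
  have := orbit_root_osize t 0; rewrite addn0.
  case: (osize t) f0 => // f _ E0.
  by rewrite big_ord_recr big_ord_recl /= E0 mulrC.
by rewrite -[in RHS]E' coef_map /= /frob_pow -hq.
Qed.

(** A nonconstant divisor has a root in [L], which lies in the orbit; by [root_frob] it then
    vanishes on the whole orbit, so the polynomial divides it. *)
Lemma irreducible_Mpoly (t : Sigma q pr e) (Q : {poly F}) :
  map_poly iota Q = Mpoly zeta eta t -> irreducible_poly Q.
Proof.
rewrite MpolyE => QM.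
split.
  rewrite -(size_map_poly iota) QM.
  rewrite -prod_orbit size_prod_XsubC size_mkseq ltnS.
  exact: orbit_size_gt0.
move=> d; rewrite -(size_map_poly iota) => /closed_rootP[a da] dQ.
rewrite /eqp dQ /= -(dvdp_map iota) QM.
have : root (map_poly iota Q) a.
  by apply: root_dvdp da => //; rewrite ?dvdp_map.
rewrite QM /root horner_prod prodf_seq_eq0 => /hasP[j _ /=].
rewrite !hornerE subr_eq0 => /eqP aE; rewrite {}aE in da.
have dr i : root (map_poly iota d) (orbit_root t (j + i)).
  elim: i => [|i IH]; first by rewrite addn0.
  by rewrite addnS -addn1 -orbit_rootX expn1; exact: root_frob.
have {}dr i : root (map_poly iota d) (orbit_root t i).
  (* Indices below [j] are reached by going once around the orbit. *)
  have := dr (osize t - j + i)%N; rewrite addnA subnKC ?orbit_root_osize //.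
  exact: ltnW.
have [||c ->] := @uniq_roots_prod_XsubC _ (map_poly iota d) (orbit t).
- by apply/allP => _ /mapP[i _ ->].
- exact: uniq_orbit.
by rewrite prod_orbit dvdp_mull.
Qed.

End Factors.

(** * Cyclic codes and divisors of X^m - 1 *)

(** Factors [P] are stripped from [g] while possible; once [P] does not divide [g], the two are
    coprime and [g] divides [Q]. *)
Lemma monic_dvdp_mul_expn (F : fieldType) (P Q g : {poly F}) (N : nat) :
  irreducible_poly P -> P \is monic -> g \is monic -> g %| P ^+ N * Q ->
  exists j h, [/\ (j <= N)%N, h \is monic, h %| Q & g = P ^+ j * h].
Proof.
move=> irrP mP; elim: N g => [|N IH] g mg.
  by rewrite expr0 mul1r => gQ; exists 0%N, g; rewrite expr0 mul1r.
have [/dvdpP[g' gE]|nPg] := boolP (P %| g).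
  have mg' : g' \is monic by rewrite -(monicMr _ mP) -gE.
  rewrite gE exprSr mulrAC dvdp_mul2r ?monic_neq0 // => /(IH _ mg').
  move=> [j [h [jN mh hQ ->]]]; exists j.+1, h; split=> //.
  by rewrite exprS mulrC mulrA.
rewrite Gauss_dvdpr => [gQ|]; first by exists 0%N, g; rewrite expr0 mul1r.
rewrite coprimep_expr // coprimep_sym; apply/coprimepP => d dP dg.
have [d1|d1] := eqVneq (size d) 1%N; first by rewrite -size_poly_eq1 d1.
by case/negP: nPg; rewrite -(eqp_dvdl _ (irrP.2 d d1 dP)).
Qed.

Lemma monic_dvdp_prod_expn (F : fieldType) (T : finType) (P : T -> {poly F})
    (N : nat) (g : {poly F}) :
  (forall t, irreducible_poly (P t)) -> (forall t, P t \is monic) ->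
  g \is monic -> g %| \prod_t P t ^+ N ->
  exists2 Om : T -> nat, (forall t, (Om t <= N)%N) & g = \prod_t P t ^+ Om t.
Proof.
move=> irrP mP.
elim: (index_enum T) (index_enum_uniq T) g => [|t r IH] /= ur g mg.
  rewrite big_nil dvdp1 size_poly_eq1 eqp_monic ?monic1 // => /eqP ->.
  by exists (fun=> 0%N); rewrite ?big_nil.
case/andP: ur => tr ur; rewrite big_cons.
case/(monic_dvdp_mul_expn (irrP t) (mP t) mg) => j [h [jN mh hQ ->]].
have [Om OmN hE] := IH ur h mh hQ.
(* The enumeration has no duplicates, so changing the value at [t] leaves the exponents on [r]
   intact. *)
exists (fun u => if u == t then j else Om u) => [u|]; first by case: ifP.
rewrite big_cons eqxx hE; congr (_ * _); apply: eq_big_seq => u ur'.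
by rewrite ifN //; apply: contraNneq tr => <-.
Qed.

(** Multiplication by [X] pushes the last letter to degree [m.+1]; subtracting its multiple of
    [X^(m.+1) - 1] wraps it to degree 0. *)
Lemma rVpoly_shift (F : fieldType) (m : nat) (c : 'rV[F]_m.+1) :
  rVpoly (cyclic_shift c) =
    'X * rVpoly c - (c 0 ord_max)%:P * ('X^(m.+1) - 1).
Proof.
apply/polyP => i; rewrite coefB coefXM coefCM coefB coefXn coef1 !coef_rVpoly.
case: insubP => [j jm ji|]; last rewrite -leqNgt => im.
  rewrite mxE -{i}ji /= in jm *; case: (posnP j) => [j0|j0].
    rewrite j0 -[(_ == _)%:R]/(0 : F) -[true%:R]/(1 : F) !sub0r mulrN1 opprK.
    by congr (c 0 _); apply/val_inj; rewrite /= j0 modn_small.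
  rewrite (ltn_eqF jm).
  rewrite subrr mulr0 subr0 insubT /=; first by rewrite (leq_ltn_trans (leq_pred _)).
  move=> jm'; congr (c 0 _); apply/val_inj => /=.
  have -> : (j + m.+1).-1 = (j.-1 + m.+1)%N by case: (nat_of_ord j) j0.
  by rewrite modnDr modn_small.
rewrite (gtn_eqF (leq_trans _ im)) //= subr0.
have [->|ni] := eqVneq i m.+1.
  rewrite mulr1 /=; case: insubP => [j _ jm|]; last by rewrite ltnSn.
  by rewrite (_ : j = ord_max) ?subrr //; exact: val_inj.
rewrite mulr0 subr0; case: insubP => // j /= jm _; move: ni im jm.
case: i => //= i; rewrite eqSS neq_ltn !ltnS => /orP[] lt_im le_mi le_im.
  by move: lt_im; rewrite ltnNge le_mi.
by move: lt_im; rewrite ltnNge le_im.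
Qed.

(** * Cyclic codes and their generator polynomials *)

Section Codes.

Variables (F : finFieldType) (m : nat).
Hypothesis m_gt0 : (0 < m)%N.

Let h : {poly F} := 'X^m - 1.

Let h_monic : h \is monic. Proof. exact: monicXnsubC. Qed.

Let size_h : size h = m.+1. Proof. exact: size_XnsubC. Qed.

Let mk_h : mk_monic h = h.
Proof. by rewrite /mk_monic size_h ltnS m_gt0 h_monic. Qed.

Lemma in_qpoly_eq (f g : {poly F}) : (in_qpoly h f == in_qpoly h g) = (h %| f - g).
Proof.
rewrite -val_eqE /= mk_h -Pdiv.IdomainMonic.modpE // -Pdiv.IdomainMonic.modpE //.
by rewrite -subr_eq0 -modpN -modpD.
Qed.

(** As [g] divides the modulus [h], divisibility by [g] depends only on the class modulo [h]. *)
Lemma generated_codeP (g : {poly F}) (c : 'rV[F]_m) :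
  g %| h -> generated_code g c <-> g %| rVpoly c.
Proof.
move=> gh; split=> [[b bE]|/dvdpP[b bE]].
  have : word_class c == in_qpoly h (val b * g).
    rewrite in_qpolyM bE; apply/eqP; congr (_ * _); apply/val_inj/esym.
    apply: in_qpoly_small; apply: leq_ltn_trans (size_npoly b) _.
    by rewrite mk_h size_h.
  rewrite in_qpoly_eq => /(dvdp_trans gh).
  by rewrite dvdp_subl ?dvdp_mull.
by exists (in_qpoly h b); rewrite -in_qpolyM -bE.
Qed.

Lemma rVpoly_shift_mod (c : 'rV[F]_m) :
  exists a, rVpoly (cyclic_shift c) = 'X * rVpoly c - a%:P * h.
Proof.
by rewrite /h; case: m m_gt0 c => // m' _ c; exists (c 0 ord_max); exact: rVpoly_shift.
Qed.

Lemma dvdp_shift (g : {poly F}) (c : 'rV[F]_m) :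
  g %| h -> g %| rVpoly c -> g %| rVpoly (cyclic_shift c).
Proof.
by move=> gh gc; have [a ->] := rVpoly_shift_mod c; rewrite dvdp_sub // dvdp_mull.
Qed.

(** The code is obtained as a subspace by taking the kernel of the linear map sending a word to its
    remainder modulo [g]. *)
Lemma generated_code_cyclic (g : {poly F}) : g %| h ->
  exists2 C : {vspace 'rV[F]_m}, cyclic_code C &
    forall c, c \in C <-> generated_code g c.
Proof.
move=> gh; have g0 : g != 0 by apply: contraTneq gh => ->; rewrite dvd0p monic_neq0.
pose f (c : 'rV[F]_m) : 'rV[F]_m := poly_rV (rVpoly c %% g).
have f_lin : linear f.
  by move=> a u v; rewrite /f linearP modpD modpZl linearP.
pose fL := GRing.isLinear.Build F _ _ _ f f_lin.
pose f' : {linear _ -> _} := HB.pack f fL.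
have memE c : (c \in lker (linfun f')) = (g %| rVpoly c).
  rewrite memv_ker lfunE /= /f /dvdp.
  rewrite -(inj_eq (can_inj (@rVpolyK _ _))) linear0 poly_rV_K //.
  (* The remainder is smaller than [g], whose size is at most [m.+1], so [poly_rV] does not truncate
     it. *)
  rewrite -ltnS (leq_trans (ltn_modpN0 _ g0)) // -size_h.
  by apply: dvdp_leq => //; exact: monic_neq0.
exists (lker (linfun f')) => [c|c]; first by rewrite !memE; exact: dvdp_shift.
by rewrite memE; split=> /(generated_codeP _ gh).
Qed.

Lemma cyclic_code_generator (C : {vspace 'rV[F]_m}) : cyclic_code C ->
  exists g : {poly F}, [/\ g \is monic, g %| h & forall c, c \in C <-> g %| rVpoly c].
Proof.
move=> cycC.
(* [J] is the preimage in [F[X]] of the ideal attached to [C]; the next facts show that it is an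
   ideal closed under gcd, by Bezout. *)
pose J (f : {poly F}) := exists2 c, c \in C & h %| f - rVpoly c.
have JD f1 f2 : J f1 -> J f2 -> J (f1 + f2).
  move=> [c1 C1 H1] [c2 C2 H2]; exists (c1 + c2); first exact: memvD.
  by rewrite linearD opprD addrACA dvdp_add.
have JX f : J f -> J ('X * f).
  move=> [c Cc H]; exists (cyclic_shift c); first exact: cycC.
  have [a ->] := rVpoly_shift_mod c.
  by rewrite opprB addrCA -mulrBr addrC dvdp_add // dvdp_mull.
have JZ a f : J f -> J (a *: f).
  move=> [c Cc H]; exists (a *: c); first exact: memvZ.
  by rewrite linearZ -scalerBr -mul_polyC dvdp_mull.
have JM b f : J f -> J (b * f).
  elim/poly_ind: b f => [|b a IH] f Jf.
    by rewrite mul0r -[0](scale0r f); exact: JZ.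
  by rewrite mulrDl -mulrA mul_polyC; apply: JD; [exact/IH/JX|exact: JZ].
have Jgcd f1 f2 : J f1 -> J f2 -> J (gcdp f1 f2).
  move=> J1 J2; have [[u v] /= /eqpP[[a b] /= /andP[a0 b0] ab]] := Bezoutp f1 f2.
  rewrite -[gcdp _ _](scalerK b0) -ab.
  by do 2!apply: (JZ); apply: JD; exact: JM.
(* Starting the gcd from [h] makes the generator divide [h]; [h] itself lies in [J] through the zero
   word. *)
pose gen (r : seq 'rV[F]_m) := foldr (fun c d => gcdp (rVpoly c) d) h r.
have gen_h r : gen r %| h.
  by elim: r => //= c r; exact/dvdp_trans/dvdp_gcdr.
have gen_r r c : c \in r -> gen r %| rVpoly c.
  elim: r => //= d r IH; rewrite inE => /predU1P[->|cr]; first exact: dvdp_gcdl.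
  exact: dvdp_trans (dvdp_gcdr _ _) (IH cr).
have J_gen r : {subset r <= C} -> J (gen r).
  elim: r => [|d r IH] rC /=.
    by exists 0; rewrite ?mem0v // linear0 subr0.
  apply: Jgcd; last by apply: IH => c cr; apply: rC; rewrite inE cr orbT.
  by exists d; rewrite ?rC ?mem_head // subrr dvdp0.
pose g := gen (vbasis C).
have g0 : g != 0.
  by apply: contraTneq (gen_h (vbasis C)) => gE; rewrite -/g gE dvd0p monic_neq0.
exists ((lead_coef g)^-1 *: g).
have gN0 : (lead_coef g)^-1 != 0 by rewrite invr_eq0 lead_coef_eq0.
split=> [||c]; first by rewrite monicE lead_coefZ mulVf ?lead_coef_eq0.
  by rewrite dvdpZl // gen_h.
rewrite dvdpZl //; split=> [Cc|/dvdpP[b bE]].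
  rewrite (coord_vbasis Cc) linear_sum /=.
  apply: (big_ind (dvdp g)) => [|f1 f2|i _]; [exact: dvdp0|exact: dvdp_add|].
  by rewrite linearZ /= -mul_polyC dvdp_mull // gen_r // mem_nth ?size_tuple.
have : J (rVpoly c) by rewrite bE; apply: JM; apply: J_gen => d; exact: vbasis_mem.
case=> d Cd; rewrite -linearB => hcd.
(* [h] has degree [m] and divides the polynomial of a word of length [m], which must then vanish. *)
suff cd : rVpoly (c - d) == 0.
  suff -> : c = d by [].
  apply/subr0_eq/(can_inj (@rVpolyK _ _)); rewrite (eqP cd).
  by rewrite [RHS]linear0.
apply: contraLR hcd => cd0; apply/negP => /(dvdp_leq cd0).
by rewrite size_h leqNgt ltnS size_poly.
Qed.

End Codes.

Theorem theorem5p1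
  (p k v q : nat) (hp : prime p) (hk : (0 < k)%N) (hq : q = (p ^ k)%N)
  (F : finFieldType) (hF : #|F| = q)
  (L : closedFieldType) (iota : {rmorphism F -> L})
  (hL : algebraic_closure iota)
  (zeta : nat -> L) (hzeta : compatible_roots q zeta)
  (s : nat) (pr e : 'I_s -> nat)
  (hpr : forall i, prime (pr i)) (hodd : forall i, odd (pr i))
  (hneq : forall i, pr i != p) (hinj : injective pr)
  (he : forall i, (0 < e i)%N)
  (n m : nat) (hn : n = (\prod_(i < s) pr i ^ e i)%N) (hm : m = (p ^ v * n)%N)
  (eta : 'I_s -> int) (heta : primitive_root_system pr e eta) :
  exists MF : Sigma q pr e -> {poly F},
    (forall t, map_poly iota (MF t) = Mpoly zeta eta t) /\
    (forall Omega : Sigma q pr e -> nat, (forall t, (Omega t <= p ^ v)%N) ->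
       exists2 C : {vspace 'rV[F]_m}, cyclic_code C &
         forall c, c \in C <-> generated_code (\prod_t MF t ^+ Omega t) c) /\
    (forall C : {vspace 'rV[F]_m}, cyclic_code C ->
       exists2 Omega : Sigma q pr e -> nat, (forall t, (Omega t <= p ^ v)%N) &
         forall c, c \in C <-> generated_code (\prod_t MF t ^+ Omega t) c).
Proof.
have m0 : (0 < m)%N.
  rewrite hm hn muln_gt0 expn_gt0 prime_gt0 //=.
  by apply: prodn_gt0 => i; exact: pow_gt0.
have /fin_all_exists[MF MFE] : forall t : Sigma q pr e,
    exists Q : {poly F}, map_poly iota Q = Mpoly zeta eta t.
  by move=> t; exact: (Mpoly_descent hp hk hq hF iota hzeta hpr hodd hneq hinj he heta t).
have MF_irr t : irreducible_poly (MF t).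
  exact: (irreducible_Mpoly hp hk hq hF hzeta hpr hodd hneq hinj he heta (MFE t)).
have MF_monic t : MF t \is monic.
  rewrite -(map_monic iota) MFE.
  rewrite (MpolyE hp hk hq hzeta hpr hodd hneq hinj he heta).
  exact: monic_prod_XsubC.
have prodMF : \prod_t MF t ^+ (p ^ v) = 'X^m - 1.
  have pF : p \in [pchar {poly F}].
    by rewrite pchar_poly (@card_finPcharP F p k) // hF.
  rewrite prodrXl hm mulnC exprM.
  have -> : \prod_t MF t = 'X^n - 1.
    (* The factorization is known over [L] and is pulled back along the injective coefficient
       map. *)
    apply: (map_poly_inj iota); rewrite rmorph_prod rmorphB rmorph1 /= map_polyXn hn.
    rewrite -(prod_orbit_XsubC hp hq hzeta hpr hneq hinj he heta).
    apply: eq_bigr => t _; rewrite MFE.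
    exact: (MpolyE hp hk hq hzeta hpr hodd hneq hinj he heta).
  (* In characteristic [p], the [p ^ v]-th power is additive on [{poly F}], which turns [X^n - 1]
     into [X^m - 1]. *)
  by have := rmorphB (frob_pow v pF) 'X^n 1; rewrite rmorph1.
exists MF; split=> //; split=> [Om OmN|C cycC].
  apply: (generated_code_cyclic m0); rewrite -prodMF.
  apply: (big_ind2 (fun f g : {poly F} => f %| g)) => // [a b c d|t _]; first exact: dvdp_mul.
  exact: dvdp_exp2l.
have [g [mg gh Cg]] := cyclic_code_generator m0 cycC.
have [|Om OmN gE] := @monic_dvdp_prod_expn _ _ MF (p ^ v) g MF_irr MF_monic mg.
  by rewrite prodMF.
exists Om => // c; rewrite -gE.
by split=> [/Cg|] H; [exact/generated_codeP | apply/Cg; exact/generated_codeP].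
Qed.
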